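(* Let $\epsilon\in(0,1/2)$, $\beta=\frac{\epsilon/4}{2\log(4mn\rho/\epsilon)}$, $C=(1+\epsilon/2)^{1/\beta}$. Define $\mathbf{x}^{(0)}=\log\big(\frac{1-\epsilon}{n\rho}\big)\mathbb{1}$ and, for $k\ge1$, $\mathbf{x}^{(k)}=\mathbf{x}^{(k-1)}-\frac{\beta}{4(1+\beta)}\overline{\nabla f_r}(\mathbf{x}^{(k-1)})$. Then for every integer $k\ge 10\frac{\log^2(2\rho mC)}{\epsilon\beta}$ (a threshold which is $O(\log^3(\rho mn/\epsilon)/\epsilon^2)$), the vector $\mathbf{x}_\alpha=\exp(\mathbf{x}^{(k+1)})$ (coordinatewise) satisfies $A\mathbf{x}_\alpha\le\mathbb{1}$, $\mathbf{x}_\alpha\ge\mathbf{0}$, and $\sum_j\log(\mathbf{x}_\alpha)_j-\sum_j\log(\mathbf{x}^* )_j\ge-3\epsilon n$.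
   Context: $A\in\mathbb{R}^{m\times n}$ is entrywise nonnegative with smallest nonzero entry $1$ and largest entry $\rho$; $\mathbb{1}$ is the all-ones vector; $\log$ is natural. $\mathbf{x}^*$ is an optimal solution of the proportionally fair packing problem $\max\{\sum_j\log x_j: A\mathbf{x}\le\mathbb{1},\mathbf{x}\ge\mathbf{0}\}$. For $\mathbf{x}\in\mathbb{R}^n$ define $f_r(\mathbf{x})=-\langle\mathbb{1},\mathbf{x}\rangle+\frac{C\beta}{1+\beta}\sum_{i=1}^m(A\exp(\mathbf{x}))_i^{(1+\beta)/\beta}$, and its truncated gradient $\overline{\nabla_j f_r}(\mathbf{x})=\nabla_j f_r(\mathbf{x})$ if $\nabla_j f_r(\mathbf{x})\in[-1,1]$, and $=1$ otherwise. *)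

(* Defs.v *)
From HB Require Import structures.
From mathcomp Require Import all_boot all_order all_algebra.
From mathcomp Require Import all_classical all_reals all_analysis.

Set Implicit Arguments.
Unset Strict Implicit.
Unset Printing Implicit Defensive.

Import Order.TTheory GRing.Theory Num.Theory.
Import numFieldNormedType.Exports.

Local Open Scope ring_scope.

Definition normalized_matrix (R : realType) (m n : nat) (A : 'M[R]_(m, n))
    (rho : R) : Prop :=
  [/\ forall i j, 0 <= A i j,
      (exists i j, A i j = 1) /\ (forall i j, A i j != 0 -> 1 <= A i j)
    & (exists i j, A i j = rho) /\ (forall i j, A i j <= rho)].

Definition packing_feasible (R : realType) (m n : nat) (A : 'M[R]_(m, n))
    (x : 'cV[R]_n) : Prop :=
  (forall i, (A *m x) i 0 <= 1) /\ (forall j, 0 <= x j 0).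

(* The library's real logarithm has [ln 0 = 0]; the extended-real [lne] gives
   the intended value -oo of the objective on the boundary of the orthant. *)
Definition fairness (R : realType) (n : nat) (x : 'cV[R]_n) : \bar R :=
  (\sum_(j < n) lne (x j 0)%:E)%E.

Definition fair_packing_optimum (R : realType) (m n : nat) (A : 'M[R]_(m, n))
    (xs : 'cV[R]_n) : Prop :=
  packing_feasible A xs /\
  forall y : 'cV[R]_n, packing_feasible A y -> (fairness y <= fairness xs)%E.

Definition exp_vec (R : realType) (n : nat) (x : 'cV[R]_n) : 'cV[R]_n :=
  map_mx (@expR R) x.

Definition beta_of (R : realType) (m n : nat) (rho eps : R) : R :=
  (eps / 4) / (2 * ln (4 * m%:R * n%:R * rho / eps)).

Definition C_of (R : realType) (eps beta : R) : R :=
  (1 + eps / 2) `^ (1 / beta).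

Definition f_r (R : realType) (m n : nat) (A : 'M[R]_(m, n)) (C beta : R)
    (x : 'cV[R]_n) : R :=
  - (\sum_(j < n) x j 0)
  + C * beta / (1 + beta)
    * \sum_(i < m) (A *m exp_vec x) i 0 `^ ((1 + beta) / beta).

Definition grad (R : realType) (n : nat) (f : 'cV[R]_n -> R) (x : 'cV[R]_n) :
    'cV[R]_n :=
  \col_(j < n) 'D_(delta_mx j 0) f x.

Definition trunc_grad (R : realType) (n : nat) (f : 'cV[R]_n -> R)
    (x : 'cV[R]_n) : 'cV[R]_n :=
  \col_(j < n) (if -1 <= grad f x j 0 <= 1 then grad f x j 0 else 1).

Fixpoint iterate (R : realType) (m n : nat) (A : 'M[R]_(m, n))
    (rho eps C beta : R) (k : nat) : 'cV[R]_n :=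
  if k is k'.+1 then
    let x := iterate A rho eps C beta k' in
    x - (beta / (4 * (1 + beta))) *: trunc_grad (f_r A C beta) x
  else const_mx (ln ((1 - eps) / (n%:R * rho))).

Definition iteration_threshold (R : realType) (m : nat) (rho eps C beta : R) :
    R :=
  10 * (ln (2 * rho * m%:R * C) ^+ 2 / (eps * beta)).

(* Main.v *)
(** Write the gradient of [f_r] at [x] as [P - 1], where [P] is the vector of
    nonnegative pressures.  Jensen's inequality for [t ^ (1 + 1/beta)] shows
    that one truncated step lowers [f_r] by at least half the step size times
    [\sum_j (P_j - 1) * min(P_j - 1, 1)].  By convexity a gap [g] to a point at
    sup-distance at most [D] forces this sum to be at least [g^2 / (2 n D^2)],
    so after [k] steps the gap is at most [4 n D^2 / (k * step size)].  The
    iterates stay in the box [-D, 0]^n with [D = ln (2 rho m C)]: they remain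
    feasible because a nearly tight constraint makes all its substantial
    coordinates shrink, and a coordinate below [- ln (rho m C)] cannot decrease, as
    its pressure is at most 1.  The comparison point is the optimum, moved
    slightly into the interior and divided by [1 + eps]; there the penalty term
    is at most [eps / 4], the coordinates lie in the same box, and the objective
    loses at most [eps n]. *)

Require Import Defs.
From HB Require Import structures.
From mathcomp Require Import all_boot all_order all_algebra.
From mathcomp Require Import all_classical all_reals all_analysis.
From mathcomp Require Import ring lra.

Set Implicit Arguments.
Unset Strict Implicit.
Unset Printing Implicit Defensive.

Import Order.TTheory GRing.Theory Num.Theory.
Import numFieldNormedType.Exports.

Local Open Scope ring_scope.

(** * Elementary inequalities for [ln], [expR] and real powers *)

Lemma ln_ge1BV (R : realType) (x : R) : 0 < x -> 1 - x^-1 <= ln x.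
Proof.
move=> x0; have := @le_ln1Dx R (x^-1 - 1).
rewrite ltrBrDl subrr invr_gt0 => /(_ x0).
by rewrite addrCA subrr addr0 lnV ?posrE//; lra.
Qed.

(** Convexity of [t ^ (1 + q)]. For positive [a] and [s], [(s / a) ^ q = exp (q ln (s / a))] is at
    least [1 + q (1 - a / s)]; multiplying by [s a ^ q] gives the tangent line. *)
Lemma powR_tangent (R : realType) (q a s : R) : 0 < q -> 0 <= a -> 0 <= s ->
  a `^ (1 + q) + (1 + q) * a `^ q * (s - a) <= s `^ (1 + q).
Proof.
move=> q0 a0 s0.
have split_pow x : 0 <= x -> x `^ (1 + q) = x * x `^ q.
  by move=> x0; rewrite powRD ?powRr1//; apply/implyP => /eqP ?; exfalso; lra.
have [->|an0] := eqVneq a 0.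
  by rewrite !powR0 ?gt_eqF//; [rewrite mulr0 mul0r addr0 powR_ge0|lra].
have {an0}a1 : 0 < a by rewrite lt_neqAle eq_sym an0.
rewrite !split_pow//.
have aq0 : 0 < a `^ q by rewrite powR_gt0.
have [->|sn0] := eqVneq s 0.
  by rewrite mul0r; have := mulr_gt0 (mulr_gt0 q0 aq0) a1; lra.
have {sn0}s1 : 0 < s by rewrite lt_neqAle eq_sym sn0.
have h : 1 + q * (1 - (s / a)^-1) <= (s / a) `^ q.
  rewrite /powR gt_eqF ?divr_gt0//.
  apply: le_trans (expR_ge1Dx _); rewrite lerD2l ler_pM2l//.
  by rewrite ln_ge1BV// divr_gt0.
have -> : s `^ q = (s / a) `^ q * a `^ q.
  by rewrite -powRM ?divr_ge0// divfK// gt_eqF.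
have := ler_wpM2l (ltW (mulr_gt0 s1 aq0)) h.
have -> : s * a `^ q * (1 + q * (1 - (s / a)^-1)) =
  a * a `^ q + (1 + q) * a `^ q * (s - a) by field; rewrite !gt_eqF.
lra.
Qed.

Lemma expR_le1DxDsqr (R : realType) (u : R) : u <= 1 / 4 ->
  expR u <= 1 + u + u ^+ 2.
Proof.
move=> hu; have h1 : 0 < 1 - u / 2 by lra.
have h2 : 1 - u / 2 <= expR (- (u / 2)) by have := expR_ge1Dx (- (u / 2)); lra.
have h3 : expR u * (expR (- (u / 2)) * expR (- (u / 2))) = 1.
  by rewrite -!expRD -[RHS]expR0; congr expR; lra.
have h4 : (1 - u / 2) * (1 - u / 2) <= expR (- (u / 2)) * expR (- (u / 2)).
  by apply: ler_pM => //; exact: ltW.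
have h5 : expR u * ((1 - u / 2) * (1 - u / 2)) <= 1.
  by rewrite -[leRHS]h3 ler_wpM2l ?expR_ge0.
rewrite -(@ler_pM2r _ ((1 - u / 2) * (1 - u / 2))) ?mulr_gt0//.
apply: le_trans h5 _.
(* [(1 + u + u^2) (1 - u/2)^2 - 1] is a quarter of this product, whose second factor is positive for
   [u <= 1/4]. *)
have : 0 <= u ^+ 2 * (1 - 3 * u + u ^+ 2) by rewrite mulr_ge0 ?sqr_ge0//; nra.
nra.
Qed.

(** Jensen's inequality with weights [a j / y]. The tangent at [w] is evaluated at [y * z j], which
    avoids dividing by [y]; in the weighted sum the linear terms cancel. *)
Lemma powR_weighted_sum_le (R : realType) (I : finType) (q : R) (a z : I -> R) :
  0 < q -> (forall j, 0 <= a j) -> (forall j, 0 <= z j) ->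
  (\sum_j a j * z j) `^ (1 + q) <=
  (\sum_j a j) `^ q * \sum_j a j * z j `^ (1 + q).
Proof.
move=> q0 a0 z0; set y := \sum_j a j; set w := \sum_j a j * z j.
have y0 : 0 <= y by exact: sumr_ge0.
have w0 : 0 <= w by apply: sumr_ge0 => j _; rewrite mulr_ge0.
have [y_eq0|yn0] := eqVneq y 0.
  have aj0 j : a j = 0.
    by have /psumr_eq0P := y_eq0; apply.
  rewrite /w big1 ?powR0; last by move=> j _; rewrite aj0 mul0r.
    by rewrite mulr_ge0 ?powR_ge0// sumr_ge0// => j _; rewrite aj0 mul0r.
  by rewrite gt_eqF//; lra.
have {yn0}y1 : 0 < y by rewrite lt_neqAle eq_sym yn0.
have key : \sum_j a j * (w `^ (1 + q) + (1 + q) * w `^ q * (y * z j - w)) <=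
    \sum_j a j * (y * z j) `^ (1 + q).
  apply: ler_sum => j _; rewrite ler_wpM2l// powR_tangent// mulr_ge0//.
have e1 : \sum_j a j * (w `^ (1 + q) + (1 + q) * w `^ q * (y * z j - w)) =
    y * w `^ (1 + q).
  under eq_bigr do rewrite mulrDr.
  rewrite big_split/= -mulr_suml -/y -[RHS]addr0; congr (_ + _).
  transitivity ((1 + q) * w `^ q * (y * w - w * y)); last by ring.
  have -> : y * w - w * y = \sum_j (y * (a j * z j) - w * a j).
    by rewrite sumrB -!mulr_sumr.
  by rewrite mulr_sumr; apply: eq_bigr => j _; ring.
have e2 : \sum_j a j * (y * z j) `^ (1 + q) =
    y * (y `^ q * \sum_j a j * z j `^ (1 + q)).
  rewrite mulrA mulr_sumr; apply: eq_bigr => j _.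
  rewrite powRM// powRD ?powRr1//; first by ring.
  by apply/implyP => _; rewrite gt_eqF.
by move: key; rewrite e1 e2 ler_pM2l.
Qed.

(** * The potential and its descent *)

Definition load (R : realType) (m n : nat) (A : 'M[R]_(m, n)) (x : 'cV[R]_n)
    (i : 'I_m) : R :=
  \sum_j A i j * expR (x j 0).

(** The penalty's contribution to the gradient of [f_r], for [q = 1 / beta]. *)
Definition pressure (R : realType) (m n : nat) (A : 'M[R]_(m, n)) (C q : R)
    (x : 'cV[R]_n) (j : 'I_n) : R :=
  C * \sum_i load A x i `^ q * (A i j * expR (x j 0)).

Lemma derive_line (R : realType) (V : normedModType R) (f : V -> R) (a v : V) :
  'D_v f a = 'D_1 (fun h : R => f (h *: v + a)) 0.
Proof.
rewrite /derive.
apply: (congr1 (fun F : R -> R => lim (F @ 0^')%classic)).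
apply/funext => h /=.
by rewrite scale0r add0r addr0 [h *: 1]mulr1.
Qed.

Section Potential.
Variables (R : realType) (m n : nat) (A : 'M[R]_(m, n)) (C beta : R).
Hypothesis A_ge0 : forall i j, 0 <= A i j.
Hypothesis beta_gt0 : 0 < beta.
Hypothesis C_ge0 : 0 <= C.
Implicit Types (x u : 'cV[R]_n) (i : 'I_m) (j : 'I_n).

Let q := beta^-1.

Let q_gt0 : 0 < q. Proof. by rewrite invr_gt0. Qed.

Let q1_gt0 : 0 < 1 + q. Proof. by rewrite addr_gt0. Qed.

Lemma mulmx_exp_vec x i : (A *m exp_vec x) i 0 = load A x i.
Proof. by rewrite mxE; apply: eq_bigr => j _; rewrite mxE. Qed.

Lemma load_ge0 x i : 0 <= load A x i.
Proof. by apply: sumr_ge0 => j _; rewrite mulr_ge0 ?expR_ge0. Qed.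

Lemma pressure_ge0 x j : 0 <= pressure A C q x j.
Proof.
rewrite mulr_ge0// sumr_ge0// => i _.
by rewrite mulr_ge0 ?powR_ge0// mulr_ge0 ?expR_ge0.
Qed.

Lemma f_rE x : f_r A C beta x =
  - (\sum_j x j 0) + C / (1 + q) * \sum_i load A x i `^ (1 + q).
Proof.
rewrite /f_r; congr (_ + _ * _).
  by rewrite /q; field; rewrite !gt_eqF ?addr_gt0//.
apply: eq_bigr => i _; rewrite mulmx_exp_vec; congr powR.
by rewrite /q; field; rewrite gt_eqF.
Qed.

Lemma load_shift x i j (h : R) : load A (h *: delta_mx j 0 + x) i =
  load A x i + A i j * expR (x j 0) * (expR h - 1).
Proof.
rewrite /load (bigD1 j)//= [in RHS](bigD1 j)//= !mxE !eqxx mulr1 expRD.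
rewrite -!addrA [X in _ = _ + X]addrC addrA; congr (_ + _); first by ring.
by apply: eq_bigr => k kj; rewrite !mxE (negbTE kj) mulr0 add0r.
Qed.

Lemma is_derive_load_powR x i j :
  is_derive (0 : R) 1
    (fun h => (load A x i + A i j * expR (x j 0) * (expR h - 1)) `^ (1 + q))
    ((1 + q) * load A x i `^ q * (A i j * expR (x j 0))).
Proof.
set y := load A x i; set a := A i j * _.
have a_ge0 : 0 <= a by rewrite mulr_ge0 ?expR_ge0.
have le_ay : a <= y.
  rewrite /y /load (bigD1 j)//= lerDl sumr_ge0// => k _.
  by rewrite mulr_ge0 ?expR_ge0.
(* The derivative rule for powers needs a positive base. If the load vanishes, so does its summand
   [a], and the function is constant. *)
have [y0|yn0] := eqVneq y 0.
  have a0 : a = 0 by apply/eqP; rewrite eq_le a_ge0 -y0 le_ay.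
  have -> : (fun h => (y + a * (expR h - 1)) `^ (1 + q)) = cst 0.
    by apply/funext => h /=; rewrite y0 a0 mul0r addr0 powR0// gt_eqF.
  by rewrite a0 mulr0; exact: is_derive_cst.
have y_gt0 : 0 < y by rewrite lt_neqAle eq_sym yn0 load_ge0.
have g_deriv : is_derive (0 : R) 1 (fun h => y + a * (expR h - 1)) a.
  have -> : (fun h => y + a * (expR h - 1)) =
    (cst y + a *: (expR - cst 1))%R :> (R -> R) by apply/funext.
  have h : is_derive (0 : R) 1 (cst y + a *: (expR - cst 1))%R
      (0 + a *: (expR 0 - 0)).
    by apply: is_deriveD; apply: is_deriveZ; apply: is_deriveB.
  by apply: (is_derive_eq h); rewrite add0r subr0 expR0 [LHS]mulr1.
have g0 : y + a * (expR 0 - 1) = y by rewrite expR0 subrr mulr0 addr0.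
have f_deriv : is_derive (y + a * (expR 0 - 1)) 1 (@powR R ^~ (1 + q))
    ((1 + q) * y `^ q).
  rewrite g0; have := is_derive1_powR (1 + q) y_gt0.
  by rewrite addrAC subrr add0r.
exact: (is_derive1_comp (f := @powR R ^~ (1 + q))).
Qed.

Lemma gradE x j : grad (f_r A C beta) x j 0 = -1 + pressure A C q x j.
Proof.
rewrite mxE.
pose phi (h : R) := f_r A C beta (h *: delta_mx j 0 + x).
have -> : 'D_(delta_mx j 0) (f_r A C beta) x = 'D_1 phi 0.
  exact: derive_line.
have phiE : phi = (cst (- (\sum_j x j 0)) - id + (C / (1 + q)) *:
    \sum_i (fun h => (load A x i +
       A i j * expR (x j 0) * (expR h - 1)) `^ (1 + q)))%R.
  apply/funext => h; rewrite /phi f_rE !fctE; congr (_ + _).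
    rewrite -opprD; congr (- _).
    under eq_bigr do rewrite !mxE.
    rewrite big_split/= addrC; congr (_ + _).
    rewrite (bigD1 j)//= !eqxx mulr1 big1 ?addr0// => k kj.
    by rewrite (negbTE kj) mulr0.
  rewrite /GRing.scale/= fct_sumE; congr (_ * _).
  by apply: eq_bigr => i _; rewrite load_shift.
have phi_deriv : is_derive (0 : R) 1 phi (0 - 1 + (C / (1 + q)) *:
    \sum_i ((1 + q) * load A x i `^ q * (A i j * expR (x j 0)))).
  rewrite phiE; apply: is_deriveD; apply: is_deriveZ.
  apply: is_derive_sum => i.
  exact: is_derive_load_powR.
rewrite derive_val sub0r /pressure; congr (_ + _).
rewrite /GRing.scale/= -mulrA; congr (_ * _).
rewrite mulr_sumr; apply: eq_bigr => i _.
by field; rewrite gt_eqF.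
Qed.

Local Notation G x j := (pressure A C q x j - 1).

(** Nonnegative pressures keep the gradient at least [-1], so the truncation acts only from
    above. *)
Lemma trunc_gradE x j : trunc_grad (f_r A C beta) x j 0 = Num.min (G x j) 1.
Proof.
rewrite mxE gradE// [-1 + _]addrC lerBrDl subrr pressure_ge0//=.
by case: leP.
Qed.

Lemma sum_pressure x (v : 'I_n -> R) : \sum_j pressure A C q x j * v j =
  C * \sum_i load A x i `^ q * \sum_j A i j * expR (x j 0) * v j.
Proof.
under eq_bigr do rewrite /pressure -mulrA mulr_suml.
rewrite -mulr_sumr exchange_big/=; congr (_ * _); apply: eq_bigr => i _.
by rewrite mulr_sumr; apply: eq_bigr => j _; rewrite !mulrA.
Qed.

(** The gradient inequality for the convex [f_r], from two tangent lines: that of [t ^ (1 + q)] at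
    each load and that of the exponential in each coordinate. *)
Lemma f_r_sub_le x u :
  f_r A C beta x - f_r A C beta u <= \sum_j G x j * (x j 0 - u j 0).
Proof.
(* Stated for plain reals so that [lra] does not meet the big sums; the same device recurs below. *)
have lin (sx su sp lx lu : R) :
  lx + sp <= lu -> (- sx + lx) - (- su + lu) <= - sp - sx + su by lra.
have load_tangent i : load A x i `^ (1 + q) + (1 + q) * load A x i `^ q *
    (\sum_j A i j * expR (x j 0) * (u j 0 - x j 0)) <= load A u i `^ (1 + q).
  apply: le_trans (powR_tangent q_gt0 (load_ge0 x i) (load_ge0 u i)).
  rewrite lerD2l; apply: ler_wpM2l.
    by rewrite mulr_ge0 ?powR_ge0// ltW.
  rewrite /load -sumrB; apply: ler_sum => j _.
  have -> : A i j * expR (u j 0) - A i j * expR (x j 0) =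
      A i j * expR (x j 0) * (expR (u j 0 - x j 0) - 1).
    by rewrite mulrBr mulr1 -mulrA -expRD addrCA subrr addr0.
  rewrite ler_wpM2l ?mulr_ge0 ?expR_ge0//.
  by have := expR_ge1Dx (u j 0 - x j 0); lra.
have := ler_sum (index_enum 'I_m) (fun i (_ : true) => load_tangent i).
rewrite big_split/=.
have -> : \sum_i (1 + q) * load A x i `^ q *
      (\sum_j A i j * expR (x j 0) * (u j 0 - x j 0)) =
    (1 + q) * \sum_i load A x i `^ q *
      (\sum_j A i j * expR (x j 0) * (u j 0 - x j 0)).
  by rewrite mulr_sumr; apply: eq_bigr => i _; rewrite mulrA.
set S := \sum_i _ * _ => /(ler_wpM2l (divr_ge0 C_ge0 (ltW q1_gt0))).
rewrite mulrDr [C / _ * ((1 + q) * S)]mulrA divfK ?gt_eqF// -sum_pressure => h.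
rewrite !f_rE// -/q.
have -> : \sum_j G x j * (x j 0 - u j 0) =
    - (\sum_j pressure A C q x j * (u j 0 - x j 0))
    - (\sum_j x j 0) + \sum_j u j 0.
  by rewrite -!sumrN -!big_split/=; apply: eq_bigr => j _; ring.
exact: lin h.
Qed.

(* Jensen's inequality bounds the growth of every load to the power [1 + q] by
   the weighted growth of its coordinates, so no Hessian is needed. *)
Lemma f_r_shift_le x (d : 'cV[R]_n) : f_r A C beta (x + d) - f_r A C beta x <=
  - (\sum_j d j 0) +
  (1 + q)^-1 * \sum_j pressure A C q x j * (expR ((1 + q) * d j 0) - 1).
Proof.
have lin (sx sd sp lx ly : R) :
  ly - lx <= sp -> (- (sx + sd) + ly) - (- sx + lx) <= - sd + sp by lra.
have load_jensen i : load A (x + d) i `^ (1 + q) - load A x i `^ (1 + q) <=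
    load A x i `^ q *
    \sum_j A i j * expR (x j 0) * (expR ((1 + q) * d j 0) - 1).
  have a_ge0 j : 0 <= A i j * expR (x j 0) by rewrite mulr_ge0 ?expR_ge0.
  have := powR_weighted_sum_le q_gt0 a_ge0 (fun j => expR_ge0 (d j 0)).
  have -> : \sum_j A i j * expR (x j 0) * expR (d j 0) = load A (x + d) i.
    by apply: eq_bigr => j _; rewrite mxE expRD mulrA.
  rewrite -/(load A x i) => /le_trans h; rewrite lerBlDr; apply: h.
  have -> : load A x i `^ (1 + q) = load A x i `^ q * load A x i.
    rewrite mulrC powRD ?powRr1 ?load_ge0//.
    by apply/implyP; rewrite gt_eqF.
  rewrite -mulrDr ler_wpM2l ?powR_ge0// /load -big_split/=.
  apply: ler_sum => j _.
  by rewrite [(1 + q) * _]mulrC expRM mulrBr mulr1 subrK.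
have := ler_sum (index_enum 'I_m) (fun i (_ : true) => load_jensen i).
rewrite sumrB => /(ler_wpM2l (divr_ge0 C_ge0 (ltW q1_gt0))).
set S := \sum_i (_ `^ q * _).
have -> : C / (1 + q) * S = (1 + q)^-1 *
    \sum_j pressure A C q x j * (expR ((1 + q) * d j 0) - 1).
  by rewrite sum_pressure mulrA [_^-1 * C]mulrC.
rewrite mulrBr => h.
rewrite !f_rE// -/q.
have -> : \sum_j (x + d) j 0 = \sum_j x j 0 + \sum_j d j 0.
  by rewrite -big_split/=; apply: eq_bigr => j _; rewrite mxE.
exact: lin h.
Qed.

(** The step size is tuned so that [(1 + q) * eta = 1 / 4]: the exponents in [f_r_shift_le] become
    [- g / 4 <= 1 / 4], where [expR] has a quadratic upper bound, and the quadratic term costs at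
    most half of the linear gain. *)
Lemma f_r_step_le x : f_r A C beta
    (x - (beta / (4 * (1 + beta))) *: trunc_grad (f_r A C beta) x) <=
  f_r A C beta x -
  beta / (8 * (1 + beta)) * \sum_j G x j * Num.min (G x j) 1.
Proof.
have alg (P g e : R) : P * g ^+ 2 <= 2 * ((P - 1) * g) ->
    P * (e - 1) <= P * (- (g / 4) + (- (g / 4)) ^+ 2) ->
  g + 4 * (P * (e - 1)) <= - (1 / 2 * ((P - 1) * g)) by rewrite !expr2; lra.
set eta := beta / (4 * (1 + beta)).
have eta_gt0 : 0 < eta by rewrite divr_gt0// mulr_gt0// addr_gt0.
have eta_q : (1 + q) * eta = 1 / 4.
  by rewrite /q /eta; field; rewrite !gt_eqF ?addr_gt0.
have q1V : (1 + q)^-1 = 4 * eta.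
  by rewrite /q /eta; field; rewrite !gt_eqF ?addr_gt0.
have -> : beta / (8 * (1 + beta)) = eta / 2.
  by rewrite /eta; field; rewrite !gt_eqF ?addr_gt0.
rewrite -lerBlDl.
apply: (le_trans (f_r_shift_le x (- (eta *: trunc_grad (f_r A C beta) x)))).
rewrite q1V mulr_sumr mulr_sumr -!sumrN -big_split/=.
apply: ler_sum => j _.
have -> : (- (eta *: trunc_grad (f_r A C beta) x)) j 0 =
    - (eta * Num.min (G x j) 1).
  by rewrite [LHS]mxE [X in - X]mxE trunc_gradE.
set P := pressure A C q x j.
set g := Num.min _ _.
have P_ge0 : 0 <= P by exact: pressure_ge0.
have g_ge : -1 <= g by rewrite le_min; apply/andP; split; lra.
have -> : (1 + q) * - (eta * g) = - (g / 4).
  by rewrite mulrN mulrA eta_q mul1r mulrC.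
have hu : expR (- (g / 4)) <= 1 + - (g / 4) + (- (g / 4)) ^+ 2.
  by apply: expR_le1DxDsqr; lra.
(* Either [P <= 2] and [g = P - 1], or [g = 1] and [P <= 2 (P - 1)]. *)
have hPg : P * g ^+ 2 <= 2 * ((P - 1) * g).
  rewrite /g; case: (leP (P - 1) 1) => hP; last by nra.
  have := sqr_ge0 (P - 1); nra.
have : P * (expR (- (g / 4)) - 1) <= P * (- (g / 4) + (- (g / 4)) ^+ 2).
  by rewrite ler_wpM2l//; lra.
move=> /(alg P g _ hPg) /(ler_wpM2l (ltW eta_gt0)) h.
have -> : - - (eta * g) + 4 * eta * (P * (expR (- (g / 4)) - 1)) =
  eta * (g + 4 * (P * (expR (- (g / 4)) - 1))) by ring.
have -> : - (eta / 2 * ((P - 1) * g)) = eta * - (1 / 2 * ((P - 1) * g)).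
  by field.
exact: h.
Qed.

(** With [d] the gap per coordinate, convexity bounds [n d^2] by the sum of the termwise estimates,
    whose part [n d^2 / 2] is absorbed on the left. *)
Lemma sqr_f_r_gap_le x u (D : R) :
    (forall j, `|x j 0 - u j 0| <= D) ->
    let gap := f_r A C beta x - f_r A C beta u in
    0 < gap -> gap <= n%:R * D ->
  gap ^+ 2 <= 2 * n%:R * D ^+ 2 * \sum_j G x j * Num.min (G x j) 1.
Proof.
move=> xuD gap gap_gt0 gapD.
have n_gt0 : 0 < n%:R :> R.
  rewrite lt_neqAle ler0n andbT eq_sym; apply/eqP => n0.
  by move: gapD; rewrite n0 mul0r; lra.
pose d := gap / n%:R.
have d_gt0 : 0 < d by rewrite divr_gt0.
have dD : d <= D by rewrite ler_pdivrMr// mulrC.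
have gapE : gap = n%:R * d by rewrite /d mulrC divfK// gt_eqF.
have D_gt0 : 0 < D by exact: lt_le_trans dD.
(* For [G <= 1] this is the arithmetic-geometric mean inequality for [d] and [D |G|]; for [G > 1]
   only a linear term is available, and [d <= D] suffices. *)
have termwise j : d * (G x j * (x j 0 - u j 0)) <=
    d ^+ 2 / 2 + D ^+ 2 * (G x j * Num.min (G x j) 1).
  apply: (@le_trans _ _ (d * (`|G x j| * D))).
    apply: ler_wpM2l; first exact: ltW.
    by rewrite (le_trans (ler_norm _))// normrM ler_wpM2l.
  case: (leP (G x j) 1) => hG.
    have -> : G x j * G x j = `|G x j| ^+ 2.
      by rewrite -normrX ger0_norm ?sqr_ge0.
    have := sqr_ge0 (d - D * `|G x j|); have := sqr_ge0 (D * `|G x j|).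
    by rewrite !expr2; lra.
  rewrite ger0_norm; last by lra.
  have : 0 <= D * (D - d) * G x j by rewrite !mulr_ge0//; lra.
  by have := sqr_ge0 d; lra.
have := ler_sum (index_enum 'I_n) (fun j (_ : true) => termwise j).
rewrite -mulr_sumr big_split/= sumr_const card_ord -mulr_sumr.
rewrite -[_ *+ n]mulr_natl.
have := ler_wpM2l (ltW d_gt0) (f_r_sub_le x u).
rewrite -/gap; set S := \sum_j _ * Num.min _ _ => h1 h2.
have h3 : d * gap <= n%:R * (d ^+ 2 / 2) + D ^+ 2 * S by exact: le_trans h1 h2.
have := ler_wpM2l (ltW n_gt0) h3; rewrite gapE; nra.
Qed.

End Potential.

(** Discrete counterpart of [d' = - d^2 / B], which decays like [B / k]. With [t = d k / B] and
    [k t <= 1], the induction step is [(k + 1) (t - t^2) <= (1 + t) (1 - t) <= 1]; monotonicity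
    handles gaps that are already nonpositive. *)
Lemma reciprocal_decay (R : realType) (d : nat -> R) (B : R) : 0 < B ->
    d 0 <= B -> (forall k, d k.+1 <= d k) ->
    (forall k, 0 < d k -> d k.+1 <= d k - d k ^+ 2 / B) ->
  forall k, k%:R * d k <= B.
Proof.
move=> B_gt0 d0B d_mono d_decay k.
have dB k' : d k' <= B.
  by elim: k' => // k' IH; exact: le_trans IH.
elim: k => [|k IH]; first by rewrite mul0r ltW.
have [dk_le0|dk_gt0] := leP (d k) 0.
  apply: le_trans (ltW B_gt0); rewrite mulr_ge0_le0//.
  exact: le_trans dk_le0.
pose t := d k / B.
have t_gt0 : 0 < t by rewrite divr_gt0.
have t_le1 : t <= 1 by rewrite ler_pdivrMr// mul1r.
have dE : d k = B * t by rewrite /t mulrC divfK// gt_eqF.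
have kt : k%:R * t <= 1.
  by rewrite -(ler_pM2l B_gt0) mulr1 mulrCA -dE.
have step : d k.+1 <= B * (t - t ^+ 2).
  apply: le_trans (d_decay _ dk_gt0) _; rewrite dE le_eqVlt; apply/orP; left.
  by apply/eqP; field; rewrite gt_eqF.
apply: (@le_trans _ _ (k.+1%:R * (B * (t - t ^+ 2)))).
  by rewrite ler_wpM2l.
rewrite mulrCA -[leRHS]mulr1 ler_pM2l// -natr1.
have k_ge0 : 0 <= k%:R :> R by [].
move: (k%:R : R) kt k_ge0 t_gt0 t_le1; clear; move: t => t K; nra.
Qed.

(** * Bounds on [beta], [C] and the iteration threshold *)

Section ParameterBounds.
Variables (R : realType) (m n : nat) (rho eps : R).
Hypothesis m_gt0 : (0 < m)%N.
Hypothesis n_gt0 : (0 < n)%N.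
Hypothesis rho_ge1 : 1 <= rho.
Hypothesis eps_gt0 : 0 < eps.
Hypothesis eps_lt : eps < 1 / 2.

Let N := 4 * m%:R * n%:R * rho / eps.
Let beta := beta_of m n rho eps.
Let C := C_of eps beta.

Let mR : 1 <= m%:R :> R. Proof. by rewrite ler1n. Qed.
Let nR : 1 <= n%:R :> R. Proof. by rewrite ler1n. Qed.

Local Ltac params_lra := move: rho_ge1 eps_gt0 eps_lt mR nR => *; lra.
Local Ltac params_nra := move: rho_ge1 eps_gt0 eps_lt mR nR => *; nra.

Lemma size_param_ge : 8 * (m%:R * n%:R * rho) <= N.
Proof.
have h : 0 <= m%:R * n%:R * rho by rewrite !mulr_ge0//; params_lra.
by rewrite /N ler_pdivlMr//; have := ler_wpM2l h (ltW eps_lt); params_lra.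
Qed.

Let mnrho_ge1 : 1 <= m%:R * n%:R * rho.
Proof. by rewrite !mulr_ege1. Qed.

Lemma size_param_ge8 : 8 <= N.
Proof. by have := size_param_ge; have := mnrho_ge1; params_lra. Qed.

Let N_gt0 : 0 < N. Proof. by have := size_param_ge8; params_lra. Qed.

Lemma ln2_ge_half : 1 / 2 <= ln 2 :> R.
Proof. by have := @ln_ge1BV R 2; params_lra. Qed.

Lemma ln_size_param_ge : 3 / 2 <= ln N.
Proof.
apply: (@le_trans _ _ (ln (2 ^+ 3))).
  by rewrite lnXn// -mulr_natl; have := ln2_ge_half; params_lra.
by rewrite ler_ln ?posrE//; have := size_param_ge8; params_lra.
Qed.

Let L_gt0 : 0 < ln N. Proof. by have := ln_size_param_ge; params_lra. Qed.

Lemma beta_ofE : beta = eps / (8 * ln N).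
Proof. by rewrite /beta /beta_of -/N; field; rewrite gt_eqF. Qed.

Lemma beta_ofV : beta^-1 = 8 * ln N / eps.
Proof. by rewrite beta_ofE invf_div. Qed.

Lemma beta_of_gt0 : 0 < beta.
Proof. by rewrite beta_ofE divr_gt0// mulr_gt0. Qed.

Lemma beta_of_le : beta <= 1 / 24.
Proof.
rewrite beta_ofE ler_pdivrMr ?mulr_gt0//.
by have := ln_size_param_ge; params_lra.
Qed.

Let eps2_gt0 : 0 < 1 + eps / 2. Proof. by params_lra. Qed.

Lemma C_ofE : C = (1 + eps / 2) `^ beta^-1.
Proof. by rewrite /C /C_of mul1r. Qed.

Lemma C_of_gt0 : 0 < C.
Proof. by rewrite C_ofE powR_gt0. Qed.

Lemma ln_C_of : ln C = 8 * ln N / eps * ln (1 + eps / 2).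
Proof. by rewrite C_ofE ln_powR beta_ofV. Qed.

Lemma ln_C_of_le : ln C <= 4 * ln N.
Proof.
have h : ln (1 + eps / 2) <= eps / 2 by apply: le_ln1Dx; params_lra.
rewrite ln_C_of.
apply: le_trans (ler_wpM2l _ h) _; first by rewrite divr_ge0 ?mulr_ge0// ltW.
by rewrite le_eqVlt; apply/orP; left; apply/eqP; field; rewrite gt_eqF.
Qed.

Lemma ln_C_of_ge : 3 * ln N <= ln C.
Proof.
rewrite ln_C_of.
(* The constant [2 / 5] comes from [1 + eps / 2 <= 5 / 4], and [8 * 2 / 5] still exceeds [3]. *)
have h : 2 / 5 * eps <= ln (1 + eps / 2).
  apply: le_trans (ln_ge1BV eps2_gt0).
  have -> : 1 - (1 + eps / 2)^-1 = eps / 2 / (1 + eps / 2).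
    by field; rewrite gt_eqF//; params_lra.
  by rewrite ler_pdivlMr//; params_nra.
apply: le_trans (ler_wpM2l _ h); last by rewrite divr_ge0 ?mulr_ge0// ltW.
have -> : 8 * ln N / eps * (2 / 5 * eps) = 16 / 5 * ln N.
  by field; rewrite gt_eqF.
by have := L_gt0; params_lra.
Qed.

Lemma C_of_ge : N ^+ 3 <= C.
Proof.
rewrite -ler_ln ?posrE ?exprn_gt0 ?C_of_gt0// lnXn// -mulr_natl.
exact: ln_C_of_ge.
Qed.

(** Since [beta^-1 * eps / 8 = ln N], the power [beta^-1] amplifies a margin of [eps / 8] below [1]
    into the factor [N^-1]. *)
Lemma C_of_powR_le (Y : R) : 0 <= Y -> (1 + eps / 2) * Y <= 1 - eps / 8 ->
  C * Y `^ beta^-1 <= N^-1.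
Proof.
move=> Y_ge0 hY; have eY : (1 + eps / 2) * Y <= expR (- (eps / 8)).
  by apply: le_trans hY _; have := expR_ge1Dx (- (eps / 8)); params_lra.
rewrite C_ofE -powRM//; last exact: ltW.
apply: (@le_trans _ _ (expR (- (eps / 8)) `^ beta^-1)).
  apply: ge0_ler_powR => //; first by rewrite invr_ge0 ltW// beta_of_gt0.
  - by rewrite nnegrE mulr_ge0// ltW.
  - by rewrite nnegrE expR_ge0.
rewrite -expRM beta_ofV.
have -> : - (eps / 8) * (8 * ln N / eps) = - ln N by field; rewrite gt_eqF.
by rewrite expRN lnK.
Qed.

Let D := ln (2 * rho * m%:R * C).

Let rhom_gt0 : 0 < 2 * rho * m%:R.
Proof. by rewrite !mulr_gt0//; params_lra. Qed.

Lemma ln_diameterE : D = ln (2 * rho * m%:R) + ln C.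
Proof. by rewrite /D lnM ?posrE ?C_of_gt0. Qed.

Lemma expR_diameter : expR D = 2 * rho * m%:R * C.
Proof. by rewrite lnK// posrE mulr_gt0// C_of_gt0. Qed.

Lemma diameter_ge1 : 1 <= D.
Proof.
rewrite ln_diameterE; have := ln_C_of_ge; have := ln_size_param_ge.
suff : 0 <= ln (2 * rho * m%:R) by params_lra.
by rewrite ln_ge0// !mulr_ege1//; params_lra.
Qed.

Lemma diameter_le : D <= 5 * ln N.
Proof.
rewrite ln_diameterE; have := ln_C_of_le.
suff : ln (2 * rho * m%:R) <= ln N by params_lra.
rewrite ler_ln ?posrE//; apply: le_trans size_param_ge.
have rhom_ge0 : 0 <= rho * m%:R by have := rhom_gt0; params_lra.
have : 0 <= rho * m%:R * (n%:R - 1) by rewrite mulr_ge0//; params_lra.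
params_lra.
Qed.

Lemma iteration_thresholdE :
  iteration_threshold m rho eps C beta = 80 * D ^+ 2 * ln N / eps ^+ 2.
Proof.
rewrite /iteration_threshold -/D beta_ofE; field.
by rewrite !gt_eqF.
Qed.

(** As [eps < 1 / 2] and [m n rho >= 1], [l >= ln 2], so [ln N = 2 ln 2 + l <= 3 l]; with
    [D <= 5 ln N] the constant is [80 * 25 * 27 = 2 * 30 ^ 3]. *)
Lemma iteration_threshold_le : iteration_threshold m rho eps C beta <=
  2 * 30 ^+ 3 * (ln (rho * m%:R * n%:R / eps) ^+ 3 / eps ^+ 2).
Proof.
rewrite iteration_thresholdE; set l := ln (rho * m%:R * n%:R / eps).
have arg_gt0 : 0 < rho * m%:R * n%:R / eps.
  by rewrite divr_gt0// !mulr_gt0//; params_lra.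
have lE : ln N = 2 * ln 2 + l.
  have -> : N = 2 ^+ 2 * (rho * m%:R * n%:R / eps).
    by rewrite /N; field; rewrite gt_eqF.
  by rewrite lnM ?posrE ?exprn_gt0// lnXn// mulr_natl.
have l_ge : ln 2 <= l.
  rewrite ler_ln ?posrE// ler_pdivlMr//.
  by move: mnrho_ge1; rewrite [_ * _ * rho]mulrC mulrA; params_lra.
have D_ge0 : 0 <= D by have := diameter_ge1; params_lra.
have D_le : D ^+ 2 <= (5 * ln N) ^+ 2.
  by rewrite ler_pXn2r ?nnegrE ?mulr_ge0 ?(ltW L_gt0)// diameter_le.
have N_le : ln N ^+ 3 <= (3 * l) ^+ 3.
  have L_le : ln N <= 3 * l by rewrite lE; params_lra.
  by rewrite ler_pXn2r ?nnegrE ?(ltW L_gt0)// (le_trans (ltW L_gt0)).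
rewrite mulrA ler_pM2r ?invr_gt0 ?exprn_gt0//.
apply: (@le_trans _ _ (2 * 10 ^+ 3 * ln N ^+ 3)).
  have := ler_wpM2r (ltW L_gt0) D_le.
  by rewrite !exprS expr0; params_lra.
by move: N_le; rewrite exprMn; params_lra.
Qed.

End ParameterBounds.

(** * One step preserves the box *)

Definition step_size (R : realType) (beta : R) : R := beta / (4 * (1 + beta)).

Definition step (R : realType) (m n : nat) (A : 'M[R]_(m, n)) (C beta : R)
    (x : 'cV[R]_n) : 'cV[R]_n :=
  x - step_size beta *: trunc_grad (f_r A C beta) x.

Lemma step_size_gt0 (R : realType) (beta : R) : 0 < beta -> 0 < step_size beta.
Proof. by move=> b0; rewrite divr_gt0// mulr_gt0// addr_gt0. Qed.

Lemma step_size_divr (R : realType) (beta : R) : 0 < beta ->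
  step_size beta / beta <= 1 / 4.
Proof.
move=> b0; have -> : step_size beta / beta = (4 * (1 + beta))^-1.
  by rewrite /step_size; field; rewrite !gt_eqF//; lra.
rewrite div1r lef_pV2 ?posrE//; lra.
Qed.

Lemma stepE (R : realType) (m n : nat) (A : 'M[R]_(m, n)) (C beta : R)
    (x : 'cV[R]_n) (j : 'I_n) :
    (forall i j, 0 <= A i j) -> 0 < beta -> 0 <= C ->
  step A C beta x j 0 =
  x j 0 - step_size beta * Num.min (pressure A C beta^-1 x j - 1) 1.
Proof.
by move=> A0 b0 C0; rewrite [LHS]mxE [X in _ + X]mxE [X in - X]mxE trunc_gradE.
Qed.

Lemma trunc_bounds (R : realType) (P : R) : 0 <= P ->
  -1 <= Num.min (P - 1) 1 <= 1.
Proof.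
by move=> P0; rewrite le_min ge_min lexx orbT andbT; apply/andP; split; lra.
Qed.

(* Once a load exceeds [expR (- step_size beta)], every coordinate with a
   substantial share of it has truncated gradient [1] and shrinks, which
   outweighs the growth of the remaining coordinates. *)
Lemma load_step_le1 (R : realType) (m n : nat) (A : 'M[R]_(m, n)) (C beta : R)
    (x : 'cV[R]_n) : (forall i j, 0 <= A i j) -> 0 < beta -> 0 < C ->
    beta <= 1 -> 32 * n%:R <= 3 * C ->
    (forall i, load A x i <= 1) ->
  forall i, load A (step A C beta x) i <= 1.
Proof.
move=> A0 b0 C_gt0 b1 nC x_le1 i; have C0 := ltW C_gt0.
set eta := step_size beta; have eta_gt0 : 0 < eta by exact: step_size_gt0.
have eta_le : eta <= 1 / 4.
  rewrite /eta /step_size ler_pdivrMr ?mulr_gt0//; lra.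
pose E := expR eta; pose F := expR (- eta).
have EF : E * F = 1 by exact: expRxMexpNx_1.
have E_gt1 : 1 < E by rewrite expR_gt1.
have F_gt0 : 0 < F by exact: expR_gt0.
have E_le2 : E <= 2.
  have := expR_le1DxDsqr eta_le; rewrite -/E expr2; nra.
have F_le1 : F <= 1 by nra.
have y_ge0 := load_ge0 A0 x i.
have shrink j : expR (step A C beta x j 0) <= E * expR (x j 0).
  rewrite stepE// -/eta -expRD ler_expR addrC lerD2r.
  have /andP[h _] := trunc_bounds (pressure_ge0 beta A0 C0 x j).
  by have := ler_wpM2l (ltW eta_gt0) h; lra.
(* A coordinate grows at most by the factor [E], so a load up to [F = E^-1] stays feasible. *)
have [y_le|y_gt] := leP (load A x i) F.
  apply: (@le_trans _ _ (E * load A x i)).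
    rewrite /load mulr_sumr; apply: ler_sum => j _.
    by rewrite mulrCA ler_wpM2l.
  by rewrite -EF ler_pM2l// (lt_trans _ E_gt1).
have yq : 3 / 4 <= load A x i `^ beta^-1.
  apply: (@le_trans _ _ (F `^ beta^-1)).
    rewrite -expRM; have := expR_ge1Dx (- eta * beta^-1).
    have := step_size_divr b0; rewrite -/eta mulNr; lra.
  by apply: ge0_ler_powR;
    rewrite ?nnegrE ?invr_ge0 ?(ltW y_gt) ?(ltW b0) ?(ltW F_gt0).
(* Threshold for a substantial share: [C * (3 / 4 * tau) = 2], so a larger summand forces pressure
   at least [2] and truncated gradient [1]. *)
pose tau := 8 / (3 * C); have tau_gt0 : 0 < tau by rewrite divr_gt0 ?mulr_gt0.
have tauC : tau * C = 8 / 3 by rewrite /tau; field; rewrite gt_eqF.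
have share j : A i j * expR (step A C beta x j 0) <=
    F * (A i j * expR (x j 0)) + tau * (E - F).
  have a_ge0 : 0 <= A i j * expR (x j 0) by rewrite mulr_ge0 ?expR_ge0.
  have [a_small|a_big] := leP (A i j * expR (x j 0)) tau.
    have := ler_wpM2l (A0 i j) (shrink j).
    have : (A i j * expR (x j 0)) * (E - F) <= tau * (E - F).
      by rewrite ler_wpM2r//; lra.
    move: a_ge0; set a := A i j * expR (x j 0).
    by rewrite [A i j * (E * _)]mulrCA -/a; lra.
  have P_ge2 : 2 <= pressure A C beta^-1 x j.
    have : C * (3 / 4 * tau) <= pressure A C beta^-1 x j.
      rewrite /pressure ler_pM2l// (bigD1 i)//=.
      apply: ler_wpDr.
        apply: sumr_ge0 => k _.
        by rewrite mulr_ge0 ?powR_ge0// mulr_ge0 ?expR_ge0.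
      apply: ler_pM => //; exact: ltW.
    have -> : C * (3 / 4 * tau) = 3 / 4 * (tau * C) by ring.
    by rewrite tauC; lra.
  rewrite stepE// (min_idPr _); last by lra.
  rewrite mulr1 expRD -/eta -/F mulrA [_ * F]mulrC lerDl mulr_ge0//; lra.
apply: (@le_trans _ _ (F * load A x i + n%:R * (tau * (E - F)))).
  have -> : F * load A x i + n%:R * (tau * (E - F)) =
      \sum_j (F * (A i j * expR (x j 0)) + tau * (E - F)).
    by rewrite big_split/= sumr_const card_ord -mulr_sumr mulr_natl.
  exact: ler_sum.
have ntau : n%:R * tau <= 1 / 4.
  rewrite /tau mulrA ler_pdivrMr ?mulr_gt0//; lra.
have h1 : F * load A x i <= F by rewrite -[leRHS]mulr1 ler_pM2l.
have h2 : n%:R * tau * (E - F) <= 1 / 4 * (E - F) by rewrite ler_wpM2r//; lra.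
(* By [E * F = 1] this says [F + (E - F) / 4 <= 1], which is what [h1] and [h2] leave to prove. *)
have h3 : 0 <= F * ((E - 1) * (3 - E)).
  rewrite mulr_ge0 ?(ltW F_gt0)// mulr_ge0//; lra.
have h4 : F * ((E - 1) * (3 - E)) = 4 * (E * F) - E * (E * F) - 3 * F by ring.
by move: h1 h2 h3; rewrite h4 EF mulrA; lra.
Qed.

(** A coordinate with pressure at most [1] does not decrease. Otherwise feasibility gives
    [1 < P <= rho m C expR (x j 0)], and the factor [2] pays for one step, which at most halves
    [expR (x j 0)]. *)
Lemma step_lower_bound (R : realType) (m n : nat) (A : 'M[R]_(m, n))
    (C beta rho : R) (x : 'cV[R]_n) (j : 'I_n) :
    (forall i j, 0 <= A i j) -> (forall i j, A i j <= rho) ->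
    0 < beta -> beta <= 1 -> 0 < C -> (forall i, load A x i <= 1) ->
    1 <= 2 * rho * m%:R * C * expR (x j 0) ->
  1 <= 2 * rho * m%:R * C * expR (step A C beta x j 0).
Proof.
move=> A0 Arho b0 b1 C_gt0 x_le1 hx; have C0 := ltW C_gt0.
have M_ge0 : 0 <= 2 * rho * m%:R * C.
  by move: hx; rewrite -(pmulr_lge0 _ (expR_gt0 (x j 0))); lra.
have eta_gt0 := step_size_gt0 b0.
have eta_le : step_size beta <= 1 / 2.
  rewrite /step_size ler_pdivrMr ?mulr_gt0//; lra.
rewrite stepE//; set P := pressure _ _ _ _ _.
have [P_le1|P_gt1] := leP P 1.
  apply: le_trans hx _; rewrite ler_wpM2l// ler_expR lerBrDr gerDl.
  by rewrite pmulr_rle0// ge_min; apply/orP; left; lra.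
have P_le : P <= rho * m%:R * C * expR (x j 0).
  have -> : rho * m%:R * C * expR (x j 0) =
      C * \sum_(i < m) rho * expR (x j 0).
    by rewrite sumr_const card_ord -mulr_natl; ring.
  rewrite ler_pM2l//; apply: ler_sum => i _.
  rewrite -[leRHS]mul1r ler_pM ?powR_ge0 ?mulr_ge0 ?expR_ge0//.
    have -> : 1 = 1 `^ beta^-1 :> R by rewrite powR1.
    by apply: ge0_ler_powR; rewrite ?nnegrE ?invr_ge0 ?(ltW b0) ?load_ge0.
  by rewrite ler_wpM2r ?expR_ge0.
have half : 1 / 2 * expR (x j 0) <=
    expR (x j 0 - step_size beta * Num.min (P - 1) 1).
  rewrite expRD mulrC ler_pM2l ?expR_gt0//.
  have /andP[_ h] := trunc_bounds (pressure_ge0 beta A0 C0 x j).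
  have := expR_ge1Dx (- (step_size beta * Num.min (P - 1) 1)).
  have := ler_wpM2l (ltW eta_gt0) h; rewrite -/P; lra.
have := ler_wpM2l M_ge0 half.
lra.
Qed.

(** * The optimum and the comparison point *)

Lemma normalized_dims (R : realType) (m n : nat) (A : 'M[R]_(m, n)) (rho : R) :
  normalized_matrix A rho -> [/\ (0 < m)%N, (0 < n)%N & 1 <= rho].
Proof.
move=> [_ [[i [j Aij]] _] [_ Arho]]; split.
- exact: leq_ltn_trans (leq0n i) (ltn_ord i).
- exact: leq_ltn_trans (leq0n j) (ltn_ord j).
- by rewrite -Aij.
Qed.

Lemma fairness_gt0 (R : realType) (n : nat) (x : 'cV[R]_n) :
  (forall j, 0 < x j 0) -> fairness x = (\sum_j ln (x j 0))%:E.
Proof.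
by move=> x_gt0; rewrite -sumEFin; apply: eq_bigr => j _; rewrite lne_EFin.
Qed.

Lemma fairness_exp_vec (R : realType) (n : nat) (x : 'cV[R]_n) :
  fairness (exp_vec x) = (\sum_j x j 0)%:E.
Proof.
rewrite fairness_gt0 => [|j]; last by rewrite mxE expR_gt0.
by congr EFin; apply: eq_bigr => j _; rewrite mxE expRK.
Qed.

Lemma feasible_uniform (R : realType) (m n : nat) (A : 'M[R]_(m, n)) (rho : R) :
  normalized_matrix A rho -> packing_feasible A (const_mx (n%:R * rho)^-1).
Proof.
move=> nA; have [_ n_gt0 rho1] := normalized_dims nA.
have nrho : 0 < n%:R * rho by rewrite mulr_gt0 ?ltr0n//; lra.
case: nA => A0 _ [_ Arho]; split=> [i|j]; last by rewrite mxE invr_ge0 ltW.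
rewrite mxE; under eq_bigr do rewrite mxE.
rewrite -mulr_suml ler_pdivrMr// mul1r mulr_natl.
have -> : rho *+ n = \sum_(j < n) rho by rewrite sumr_const card_ord.
exact: ler_sum.
Qed.

(** A vanishing coordinate would make the objective [-oo], while the feasible uniform point has a
    finite value. *)
Lemma optimum_gt0 (R : realType) (m n : nat) (A : 'M[R]_(m, n)) (rho : R)
    (xs : 'cV[R]_n) (j : 'I_n) :
  normalized_matrix A rho -> fair_packing_optimum A xs -> 0 < xs j 0.
Proof.
move=> nA [[_ xs_ge0] /(_ _ (feasible_uniform nA)) xs_opt].
have [_ n_gt0 rho1] := normalized_dims nA.
rewrite lt_neqAle xs_ge0 andbT eq_sym; apply/eqP => xsj.
move: xs_opt; rewrite [fairness xs](_ : _ = -oo%E).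
  rewrite fairness_gt0 => [|k]; first by rewrite leeNy_eq.
  by rewrite mxE invr_gt0 mulr_gt0 ?ltr0n//; lra.
apply/esum_eqNyP; exists j; split; rewrite ?mem_index_enum//.
by rewrite xsj; exact: le0_lneNy.
Qed.

(* Otherwise the [j]-th coordinate could be doubled. *)
Lemma optimum_column_neq0 (R : realType) (m n : nat) (A : 'M[R]_(m, n))
    (rho : R) (xs : 'cV[R]_n) (j : 'I_n) :
  normalized_matrix A rho -> fair_packing_optimum A xs ->
  exists i, A i j != 0.
Proof.
move=> nA opt; have xs_gt0 k := optimum_gt0 k nA opt.
case: opt => -[xs_le1 _] xs_opt.
apply/existsP; apply: contraT; rewrite negb_exists => /forallP Aj0.
pose y : 'cV[R]_n := \col_k (xs k 0 *+ (if k == j then 2 else 1)).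
have y_gt0 k : 0 < y k 0 by rewrite mxE pmulrn_lgt0//; case: ifP.
have /xs_opt : packing_feasible A y.
  split=> [i|k]; last exact: ltW.
  apply: le_trans (xs_le1 i); rewrite !mxE le_eqVlt; apply/orP; left.
  apply/eqP; apply: eq_bigr => k _; rewrite mxE; case: eqP => // ->.
  by have := Aj0 i; rewrite negbK => /eqP ->; rewrite !mul0r.
rewrite !fairness_gt0// lee_fin leNgt; case/negP.
rewrite (bigD1 j)//= [ltRHS](bigD1 j)//=; apply: ltr_leD.
  by rewrite mxE eqxx ltr_ln ?posrE ?pmulrn_lgt0// mulr2n ltrDl.
by apply: ler_sum => k kj; rewrite mxE (negbTE kj).
Qed.

Lemma load_exp (R : realType) (m n : nat) (A : 'M[R]_(m, n)) (y : 'cV[R]_n) i :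
  (forall j, 0 < y j 0) -> load A (\col_j ln (y j 0)) i = (A *m y) i 0.
Proof.
by move=> y0; rewrite mxE; apply: eq_bigr => j _; rewrite mxE lnK// posrE.
Qed.

Lemma f_r_ge (R : realType) (m n : nat) (A : 'M[R]_(m, n)) (C beta : R)
    (x : 'cV[R]_n) : 0 < beta -> 0 <= C ->
  - (\sum_j x j 0) <= f_r A C beta x.
Proof.
move=> b0 C0; rewrite f_rE// lerDl mulr_ge0 ?divr_ge0//.
  by rewrite addr_ge0// invr_ge0 ltW.
by apply: sumr_ge0 => i _; rewrite powR_ge0.
Qed.

(** Loads are at most [Y <= 1], so the penalty is at most [m C Y ^ (1 / beta) <= m / N = eps / (4 n
    rho)]. *)
Lemma f_r_le (R : realType) (m n : nat) (A : 'M[R]_(m, n)) (rho eps Y : R)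
    (x : 'cV[R]_n) : normalized_matrix A rho -> 0 < eps < 1 / 2 ->
    0 <= Y -> Y <= 1 -> (1 + eps / 2) * Y <= 1 - eps / 8 ->
    (forall i, load A x i <= Y) ->
    let beta := beta_of m n rho eps in
  f_r A (C_of eps beta) beta x <= - (\sum_j x j 0) + eps / 4.
Proof.
move=> nA /andP[e0 e1] Y0 Y1 hY xY; set beta := beta_of _ _ _ _ => /=.
have [m0 n0 rho1] := normalized_dims nA; have [A0 _ _] := nA.
have b0 : 0 < beta by exact: beta_of_gt0.
have C0 : 0 < C_of eps beta by exact: C_of_gt0.
have q0 : 0 < beta^-1 by rewrite invr_gt0.
rewrite f_rE// lerD2l; set C := C_of eps beta.
have hN := C_of_powR_le m0 n0 rho1 e0 e1 Y0 hY; rewrite -/beta -/C in hN.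
have pow_le i : load A x i `^ (1 + beta^-1) <= Y `^ beta^-1.
  rewrite powRD ?powRr1 ?load_ge0//; last first.
    by apply/implyP; rewrite gt_eqF// addr_gt0.
  rewrite -[leRHS]mul1r ler_pM ?powR_ge0 ?load_ge0//.
    exact: le_trans Y1.
  by apply: ge0_ler_powR; rewrite ?nnegrE ?load_ge0 ?(ltW q0).
apply: (@le_trans _ _ (C * \sum_(i < m) Y `^ beta^-1)).
  apply: ler_pM; rewrite ?divr_ge0 ?(ltW C0) ?addr_ge0 ?(ltW q0)//.
  - by apply: sumr_ge0 => i _; rewrite powR_ge0.
  - by rewrite ler_pdivrMr ?addr_gt0// mulrDr mulr1 lerDl mulr_ge0 ?ltW.
  - exact: ler_sum.
rewrite sumr_const card_ord -[_ *+ m]mulr_natl mulrCA.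
apply: le_trans (ler_wpM2l (ler0n _ m) hN) _.
have mR : 1 <= m%:R :> R by rewrite ler1n.
have nR : 1 <= n%:R :> R by rewrite ler1n.
have -> : m%:R * (4 * m%:R * n%:R * rho / eps)^-1 = eps / 4 / (n%:R * rho).
  by field; rewrite !gt_eqF//; lra.
have nrho : 1 <= n%:R * rho by rewrite mulr_ege1.
rewrite ler_pdivrMr; last by lra.
by rewrite ler_peMr//; lra.
Qed.

(** * Decay of the gap, and bounds along the iterates *)

Lemma trunc_mul_ge0 (R : realType) (g : R) : 0 <= g * Num.min g 1.
Proof.
case: (leP g 1) => h; first by rewrite -expr2 sqr_ge0.
by rewrite mulr1 ltW// (lt_trans _ h).
Qed.

(** The descent coefficient [beta / (8 (1 + beta))] times the lower bound [d^2 / (2 n D^2)] on the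
    sum gives the recurrence of [reciprocal_decay] with this [B]. Monotonicity carries the initial
    bound [n D], needed by [sqr_f_r_gap_le], to every iterate. *)
Lemma f_r_gap_decay (R : realType) (m n : nat) (A : 'M[R]_(m, n))
    (C beta D : R) (x : nat -> 'cV[R]_n) (u : 'cV[R]_n) :
    (forall i j, 0 <= A i j) -> 0 < beta -> 0 <= C -> 1 <= D -> (0 < n)%N ->
    (forall k, x k.+1 = step A C beta (x k)) ->
    (forall k j, `|x k j 0 - u j 0| <= D) ->
    f_r A C beta (x 0%N) - f_r A C beta u <= n%:R * D ->
  forall k, k%:R * (f_r A C beta (x k) - f_r A C beta u) <=
    16 * n%:R * D ^+ 2 * ((1 + beta) / beta).
Proof.
move=> A0 b0 C0 D1 n_gt0.
pose B := 16 * n%:R * D ^+ 2 * ((1 + beta) / beta).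
have nR : 0 < n%:R :> R by rewrite ltr0n.
have D_gt0 : 0 < D by lra.
have b1_gt0 : 0 < 1 + beta by lra.
have D16 : 1 <= 16 * D by lra.
have bV1 : 1 <= (1 + beta) / beta by rewrite ler_pdivlMr//; lra.
have B_gt0 : 0 < B by rewrite !mulr_gt0 ?exprn_gt0 ?invr_gt0.
have nDB : n%:R * D <= B.
  have -> : B = n%:R * D * (16 * D * ((1 + beta) / beta)) by rewrite /B; ring.
  by rewrite ler_peMr ?mulr_ge0 ?(ltW nR) ?(ltW D_gt0)// mulr_ege1.
have c_gt0 : 0 < beta / (8 * (1 + beta)) by rewrite divr_gt0// mulr_gt0.
move=> xS xuD gap0.
pose S k := \sum_j (pressure A C beta^-1 (x k) j - 1) *
  Num.min (pressure A C beta^-1 (x k) j - 1) 1.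
have descent k : f_r A C beta (x k.+1) <=
    f_r A C beta (x k) - beta / (8 * (1 + beta)) * S k.
  by rewrite xS; exact: f_r_step_le.
have S_ge0 k : 0 <= S k by apply: sumr_ge0 => j _; exact: trunc_mul_ge0.
pose d k := f_r A C beta (x k) - f_r A C beta u.
have d_mono k : d k.+1 <= d k.
  rewrite lerD2r; apply: le_trans (descent k) _.
  by rewrite gerBl mulr_ge0// ltW.
have d_le k : d k <= n%:R * D.
  elim: k => [|k IH]; first exact: gap0.
  exact: le_trans (d_mono k) IH.
apply: (@reciprocal_decay _ d B B_gt0 (le_trans gap0 nDB) d_mono).
move=> k dk_gt0; rewrite addrAC lerD2r.
apply: le_trans (descent k) _; rewrite lerD2l lerN2 ler_pdivrMr//.
apply: le_trans (sqr_f_r_gap_le A0 b0 C0 (xuD k) dk_gt0 (d_le k)) _.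
rewrite -/(S k) le_eqVlt; apply/orP; left; apply/eqP; rewrite /B; field.
by rewrite !gt_eqF.
Qed.

Section Iterates.
Variables (R : realType) (m n : nat) (A : 'M[R]_(m, n)) (rho eps : R).
Hypothesis nA : normalized_matrix A rho.
Hypothesis eps_lt : 0 < eps < 1 / 2.

Let beta := beta_of m n rho eps.
Let C := C_of eps beta.
Let D := ln (2 * rho * m%:R * C).
Let x := iterate A rho eps C beta.

Lemma load_iterate0 i : load A (x 0) i <= 1 - eps.
Proof.
have [_ n_gt0 rho1] := normalized_dims nA; have /andP[e0 e1] := eps_lt.
have nrho : 0 < n%:R * rho by rewrite mulr_gt0 ?ltr0n//; lra.
have arg_gt0 : 0 < (1 - eps) / (n%:R * rho) by rewrite divr_gt0//; lra.
have [/(_ i) + _] := feasible_uniform nA.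
have -> : load A (x 0) i =
    (1 - eps) * (A *m (const_mx (n%:R * rho)^-1 : 'cV_n)) i 0.
  rewrite mxE mulr_sumr; apply: eq_bigr => j _.
  by rewrite !mxE lnK ?posrE// mulrCA.
by move=> h; rewrite ler_piMr//; lra.
Qed.

Lemma C_of_ge_dims : 64 * (8 * (m%:R * n%:R * rho)) <= C.
Proof.
have [m0 n0 rho1] := normalized_dims nA; have /andP[e0 e1] := eps_lt.
apply: le_trans (C_of_ge m0 n0 rho1 e0 e1).
have N8 := size_param_ge8 m0 n0 rho1 e0 e1.
have Nge := size_param_ge m0 n0 rho1 e0 e1.
rewrite exprSr; apply: ler_pM => //.
  by rewrite !mulr_ge0//; lra.
by rewrite expr2; nra.
Qed.

Lemma load_iterate_le1 k i : load A (x k) i <= 1.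
Proof.
have [m0 n0 rho1] := normalized_dims nA; have /andP[e0 e1] := eps_lt.
elim: k i => [|k IH] i.
  by apply: le_trans (load_iterate0 i) _; lra.
have [A0 _ _] := nA.
have b24 := beta_of_le m0 n0 rho1 e0 e1.
apply: (load_step_le1 A0) => //.
- exact: beta_of_gt0.
- exact: C_of_gt0.
- by rewrite -/beta in b24; lra.
- have := C_of_ge_dims.
  have : 1 <= m%:R * rho by rewrite mulr_ege1 ?ler1n.
  have nR : 0 <= n%:R :> R by [].
  by move=> /(ler_wpM2l nR); rewrite mulr1; lra.
Qed.

Lemma iterate_lower k j : - D <= x k j 0.
Proof.
have [m0 n0 rho1] := normalized_dims nA; have /andP[e0 e1] := eps_lt.
have [A0 _ [_ Arho]] := nA.
have mR : 1 <= m%:R :> R by rewrite ler1n.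
have nR : 1 <= n%:R :> R by rewrite ler1n.
have b24 := beta_of_le m0 n0 rho1 e0 e1; rewrite -/beta in b24.
suff : 1 <= 2 * rho * m%:R * C * expR (x k j 0).
  rewrite -[_ * C](expR_diameter m0 n0 rho1 e0 e1) -/beta -/C -/D -expRD.
  by rewrite -[X in X <= _]expR0 ler_expR -lerBlDl sub0r.
elim: k => [|k IH].
  have nrho : 0 < n%:R * rho by rewrite mulr_gt0//; lra.
  rewrite mxE lnK ?posrE; last by rewrite divr_gt0//; lra.
  rewrite mulrA ler_pdivlMr// mul1r.
  have m_rho : 1 <= m%:R * rho by rewrite mulr_ege1.
  (* At the uniform start, the bound reduces to [n <= C] because [m >= 1] and [2 (1 - eps) >= 1]. *)
  have hC : n%:R <= C.
    have : n%:R * 1 <= n%:R * (m%:R * rho) by rewrite ler_wpM2l.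
    have := C_of_ge_dims; lra.
  apply: (@le_trans _ _ (rho * C)).
    by rewrite [leLHS]mulrC; apply: ler_wpM2l => //; lra.
  have rC : 0 <= rho * C by rewrite mulr_ge0//; lra.
  have -> : 2 * rho * m%:R * C * (1 - eps) = rho * C * (m%:R * (2 * (1 - eps))).
    by ring.
  by rewrite ler_peMr// mulr_ege1//; lra.
apply: step_lower_bound => //; last exact: load_iterate_le1.
- exact: beta_of_gt0.
- lra.
- exact: C_of_gt0.
Qed.

End Iterates.

(** A nonzero entry of column [j] is at least [1], so some load dominates [expR (x j 0)]. *)
Lemma exponent_le0 (R : realType) (m n : nat) (A : 'M[R]_(m, n)) (rho : R)
    (x : 'cV[R]_n) (j : 'I_n) :
    normalized_matrix A rho -> (exists i, A i j != 0) ->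
  (forall i, load A x i <= 1) -> x j 0 <= 0.
Proof.
move=> [A0 [_ A1] _] [i Aij] /(_ i) xi; rewrite -expR_le1.
apply: le_trans xi; rewrite /load (bigD1 j)//=; apply: ler_wpDr.
  by apply: sumr_ge0 => k _; rewrite mulr_ge0 ?expR_ge0.
by rewrite ler_peMl ?expR_ge0// A1.
Qed.

(* Comparison point in the exponentiated variables. Adding a multiple of the
   uniform point keeps its logarithms bounded below; shrinking by [1 + eps]
   makes the penalty of the loads negligible. *)
Definition interior_point (R : realType) (n : nat) (rho eps : R)
    (xs : 'cV[R]_n) : 'cV[R]_n :=
  (1 + eps)^-1 *: (xs + (eps / 4) *: const_mx (n%:R * rho)^-1).

(** * The comparison point: loads, range of coordinates, loss of objective *)

Section InteriorPoint.
Variables (R : realType) (m n : nat) (A : 'M[R]_(m, n)) (rho eps : R).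
Variable xs : 'cV[R]_n.
Hypothesis nA : normalized_matrix A rho.
Hypothesis eps_lt : 0 < eps < 1 / 2.
Hypothesis xs_opt : fair_packing_optimum A xs.

Let y := interior_point rho eps xs.
Let u : 'cV[R]_n := \col_j ln (y j 0).

Lemma interior_pointE j :
  y j 0 = (xs j 0 + eps / 4 * (n%:R * rho)^-1) / (1 + eps).
Proof. by rewrite !mxE mulrC. Qed.

(** The uniform part alone suffices: [(eps / 4) / (1 + eps) >= eps / 6], as [1 + eps <= 3 / 2]. *)
Lemma interior_point_ge j : eps / 6 / (n%:R * rho) <= y j 0.
Proof.
have /andP[e0 e1] := eps_lt.
have [_ n0 rho1] := normalized_dims nA.
have nrho : 0 < (n%:R * rho)^-1 by rewrite invr_gt0 mulr_gt0 ?ltr0n//; lra.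
have xsj := optimum_gt0 j nA xs_opt.
rewrite interior_pointE ler_pdivlMr; last by lra.
move: (_^-1) nrho (xs j 0) xsj => v v0 w w0.
have : 0 <= v * eps * (1 / 2 - eps) by rewrite !mulr_ge0//; lra.
lra.
Qed.

Lemma interior_point_gt0 j : 0 < y j 0.
Proof.
have /andP[e0 e1] := eps_lt.
have [_ n0 rho1] := normalized_dims nA.
apply: lt_le_trans (interior_point_ge j).
by rewrite !divr_gt0// mulr_gt0 ?ltr0n//; lra.
Qed.

Lemma load_interior_point i : load A u i <= (1 + eps / 4) / (1 + eps).
Proof.
have /andP[e0 e1] := eps_lt.
rewrite load_exp; last exact: interior_point_gt0.
have [/(_ i) h1 _] := xs_opt.1; have [/(_ i) h2 _] := feasible_uniform nA.
rewrite mxE in h1; rewrite mxE in h2.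
rewrite -scalemxAr mulmxDr -scalemxAr !mxE.
rewrite mulrC ler_pM2r ?invr_gt0; last by lra.
apply: lerD => //.
by rewrite ler_piMr//; lra.
Qed.

Lemma ln_interior_point_ge j : ln (xs j 0) - eps <= u j 0.
Proof.
have /andP[e0 e1] := eps_lt.
have [_ n0 rho1] := normalized_dims nA.
have xsj := optimum_gt0 j nA xs_opt.
have e1_gt0 : 0 < 1 + eps by lra.
have nrho : 0 < (n%:R * rho)^-1 by rewrite invr_gt0 mulr_gt0 ?ltr0n//; lra.
rewrite mxE; apply: (@le_trans _ _ (ln (xs j 0) - ln (1 + eps))).
  by rewrite lerD2l lerN2 le_ln1Dx//; lra.
rewrite -ln_div ?posrE// ler_ln ?posrE ?divr_gt0 ?interior_point_gt0//.
rewrite interior_pointE ler_pM2r ?invr_gt0// lerDl mulr_ge0 ?(ltW nrho)//.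
by lra.
Qed.

(** Coordinates of [xs] are at most [1], and [(1 + eps / 4) / (1 + eps) <= 1 - eps / 4]. The margin
    [eps / 4] is spent in bounding the initial gap. *)
Lemma ln_interior_point_le j : u j 0 <= - (eps / 4).
Proof.
have /andP[e0 e1] := eps_lt.
have [_ n0 rho1] := normalized_dims nA.
have col_j := optimum_column_neq0 j nA xs_opt.
have xs1 : xs j 0 <= 1.
  have [A0 [_ A1] _] := nA; have [i Aij] := col_j.
  have [/(_ i) xi xs0] := xs_opt.1; apply: le_trans xi.
  rewrite mxE (bigD1 j)//=; apply: ler_wpDr.
    by apply: sumr_ge0 => k _; rewrite mulr_ge0.
  by rewrite ler_peMl// A1.
have nrho : 1 <= n%:R * rho by rewrite mulr_ege1 ?ler1n.
have nrhoV : (n%:R * rho)^-1 <= 1 by rewrite invf_le1//; lra.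
have y1 : y j 0 <= 1 - eps / 4.
  rewrite interior_pointE ler_pdivrMr; last by lra.
  have : eps / 4 * (n%:R * rho)^-1 <= eps / 4 * 1 by rewrite ler_wpM2l//; lra.
  have : 0 <= eps * (1 / 2 - eps) by rewrite mulr_ge0//; lra.
  lra.
rewrite mxE; apply: (@le_trans _ _ (y j 0 - 1)); last by lra.
have -> : y j 0 = 1 + (y j 0 - 1) by rewrite addrCA subrr addr0.
rewrite addrAC subrr add0r; apply: le_ln1Dx.
by have := interior_point_gt0 j; lra.
Qed.

(** Here [2 rho m C >= C >= N^3 >= 2 N], while [(2 N)^-1 = eps / (8 m n rho)] lies below
    [interior_point_ge]. *)
Lemma ln_interior_point_lower j :
  - ln (2 * rho * m%:R * C_of eps (beta_of m n rho eps)) <= u j 0.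
Proof.
have /andP[e0 e1] := eps_lt.
have [m0 n0 rho1] := normalized_dims nA.
have mR : 1 <= m%:R :> R by rewrite ler1n.
have nR : 1 <= n%:R :> R by rewrite ler1n.
have nrho : 0 < n%:R * rho by rewrite mulr_gt0//; lra.
have rhom : 1 <= 2 * rho * m%:R by rewrite !mulr_ege1//; lra.
set N := 4 * m%:R * n%:R * rho / eps.
have N8 : 8 <= N by exact: size_param_ge8.
have N0 : 0 < N by lra.
have CN : N ^+ 3 <= C_of eps (beta_of m n rho eps) by exact: C_of_ge.
set C := C_of _ _ in CN *.
have C0 : 0 < C by apply: lt_le_trans CN; rewrite exprn_gt0.
have NC : 2 * N <= C by apply: le_trans CN; rewrite !exprS expr0; nra.
have M0 : 0 < 2 * rho * m%:R * C by rewrite mulr_gt0//; lra.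
rewrite mxE -lnV ?posrE// ler_ln ?posrE ?invr_gt0 ?interior_point_gt0//.
apply: le_trans (interior_point_ge j).
apply: (@le_trans _ _ (2 * N)^-1).
  rewrite lef_pV2 ?posrE//; last by rewrite mulr_gt0.
  by apply: le_trans NC _; rewrite ler_peMl ?(ltW C0).
have -> : (2 * N)^-1 = eps / 8 / (n%:R * rho) * m%:R^-1.
  by rewrite /N; field; rewrite !gt_eqF//; lra.
have h : 0 <= eps / 8 / (n%:R * rho) by rewrite !divr_ge0 ?(ltW nrho) ?(ltW e0).
apply: (@le_trans _ _ (eps / 8 / (n%:R * rho))).
  by rewrite ler_piMr// invf_le1//; lra.
by rewrite ler_pM2r ?invr_gt0//; lra.
Qed.

End InteriorPoint.

(** * From the decay rate to the approximation guarantee *)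

Lemma normB_le_of_itv (R : realType) (D a b : R) :
  - D <= a -> - D <= b -> a <= 0 -> b <= 0 -> `|a - b| <= D.
Proof. by move=> *; rewrite ler_norml; apply/andP; split; lra. Qed.

(** Dividing by the threshold leaves [8 / 5 * n eps (1 + beta)], and [8 / 5 * 25 / 24 = 5 / 3]. *)
Lemma gap_le_of_threshold (R : realType) (n eps beta D gap k : R) :
    0 <= n -> 0 < eps -> 0 < beta -> beta <= 1 / 24 -> 0 < D ->
    10 * (D ^+ 2 / (eps * beta)) <= k ->
    k * gap <= 16 * n * D ^+ 2 * ((1 + beta) / beta) ->
  gap <= 5 / 3 * (n * eps).
Proof.
move=> n0 e0 b0 b24 D0 Tk kgap.
have ne0 : 0 <= n * eps by rewrite mulr_ge0 ?(ltW e0).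
have [gap_le0|gap_gt0] := leP gap 0; first by lra.
apply: (@le_trans _ _ (8 / 5 * (n * eps) * (1 + beta))); last first.
  have := ler_wpM2l ne0 b24; lra.
have T0 : 0 < 10 * (D ^+ 2 / (eps * beta)).
  by rewrite mulr_gt0// divr_gt0 ?exprn_gt0// mulr_gt0.
rewrite -(ler_pM2l T0).
have -> : 10 * (D ^+ 2 / (eps * beta)) * (8 / 5 * (n * eps) * (1 + beta)) =
    16 * n * D ^+ 2 * ((1 + beta) / beta).
  by field; rewrite !gt_eqF.
by apply: le_trans kgap; rewrite ler_pM2r.
Qed.

Theorem theorem4 (R : realType) :
  exists2 K : R, 0 < K &
  forall (m n : nat) (A : 'M[R]_(m, n)) (rho eps : R),
    normalized_matrix A rho ->
    0 < eps < 1 / 2 ->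
    let beta := beta_of m n rho eps in
    let C := C_of eps beta in
    let T := iteration_threshold m rho eps C beta in
    T <= K * (ln (rho * m%:R * n%:R / eps) ^+ 3 / eps ^+ 2) /\
    forall (xs : 'cV[R]_n), fair_packing_optimum A xs ->
    forall k : nat, T <= k%:R ->
      let xa := exp_vec (iterate A rho eps C beta k.+1) in
      [/\ forall i, (A *m xa) i 0 <= 1,
          forall j, 0 <= xa j 0
        & ((- (3 * eps * n%:R))%:E <= fairness xa - fairness xs)%E].
Proof.
exists (2 * 30 ^+ 3); first by rewrite mulr_gt0// exprn_gt0.
move=> m n A rho eps nA eps_lt beta C T.
have [m0 n0 rho1] := normalized_dims nA; have /andP[e0 e1] := eps_lt.
split; first exact: iteration_threshold_le.
move=> xs xs_opt k Tk xa.
have [A0 _ _] := nA.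
have b0 : 0 < beta by exact: beta_of_gt0.
have C0 : 0 <= C by apply/ltW; exact: C_of_gt0.
split=> [i|j|].
- by rewrite mulmx_exp_vec; exact: load_iterate_le1.
- by rewrite mxE expR_ge0.
rewrite fairness_exp_vec fairness_gt0 => [|j];
  last exact: optimum_gt0 nA xs_opt.
rewrite lee_fin.
pose D := ln (2 * rho * m%:R * C).
pose x := iterate A rho eps C beta.
pose u : 'cV[R]_n := \col_j ln (interior_point rho eps xs j 0).
pose Y := (1 + eps / 4) / (1 + eps).
have nR : 1 <= n%:R :> R by rewrite ler1n.
have D1 : 1 <= D by exact: diameter_ge1.
have e4 : - (eps / 4) <= 0 by lra.
have en : eps / 4 <= eps / 4 * n%:R by rewrite ler_peMr//; lra.
have lin0 (a b sx su : R) : a <= - sx + eps / 4 -> - su <= b ->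
  - sx <= n%:R * D -> su <= - (eps / 4) -> a - b <= n%:R * D by lra.
(* Error budget in units of [eps n]: [5 / 3] for the gap, [1] for the comparison point and [1 / 4]
   for its penalty, together below [3]. *)
have lin1 (fx fu sx su ss : R) : - sx <= fx -> fu <= - su + eps / 4 ->
    ss - n%:R * eps <= su -> fx - fu <= 5 / 3 * (n%:R * eps) ->
  - (3 * eps * n%:R) <= sx - ss by lra.
have b24 : beta <= 1 / 24 by exact: beta_of_le m0 n0 rho1 e0 e1.
have D0 : 0 < D by lra.
have Y_ge0 : 0 <= Y by rewrite divr_ge0//; lra.
have Y_le1 : Y <= 1 by rewrite ler_pdivrMr; lra.
have Y_small : (1 + eps / 2) * Y <= 1 - eps / 8.
  rewrite mulrA ler_pdivrMr; last by lra.
  have : 0 <= eps * (1 / 2 - eps) by rewrite mulr_ge0//; lra.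
  lra.
have e_small : (1 + eps / 2) * (1 - eps) <= 1 - eps / 8.
  have : 0 <= eps ^+ 2 by rewrite sqr_ge0.
  lra.
have fu_le : f_r A C beta u <= - (\sum_j u j 0) + eps / 4.
  apply: (f_r_le nA eps_lt Y_ge0 Y_le1 Y_small) => i.
  exact: load_interior_point.
have fx0_le : f_r A C beta (x 0) <= - (\sum_j x 0 j 0) + eps / 4.
  apply: (f_r_le nA eps_lt _ _ e_small); [lra|lra|].
  exact: load_iterate0.
have u_le j : u j 0 <= - (eps / 4).
  exact: ln_interior_point_le nA eps_lt xs_opt j.
have dist l j : `|x l j 0 - u j 0| <= D.
  have xl : - D <= x l j 0 by exact: iterate_lower.
  have ul : - D <= u j 0 by exact: ln_interior_point_lower nA eps_lt xs_opt j.
  have xu : x l j 0 <= 0.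
    apply: (exponent_le0 nA); first exact: optimum_column_neq0 nA xs_opt.
    exact: load_iterate_le1.
  by apply: normB_le_of_itv => //; exact: le_trans (u_le j) e4.
(* The starting penalty [eps / 4] is cancelled by the margin in [u_le]. *)
have gap0 : f_r A C beta (x 0) - f_r A C beta u <= n%:R * D.
  have sx0 : - (\sum_j x 0 j 0) <= n%:R * D.
    rewrite -sumrN mulr_natl -[in leRHS](card_ord n) -sumr_const.
    apply: ler_sum => j _; rewrite lerNl; exact: iterate_lower.
  have su : \sum_j u j 0 <= - (eps / 4).
    apply: (@le_trans _ _ (n%:R * - (eps / 4))).
      rewrite mulr_natl -[in leRHS](card_ord n) -sumr_const.
      by apply: ler_sum.
    by rewrite mulrN lerN2 [leRHS]mulrC.
  exact: lin0 fx0_le (f_r_ge A u b0 C0) sx0 su.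
(* [iterate] at a successor is convertible to [step], hence [erefl]. The index is that of the
   returned point, [k.+1]. *)
have decay := f_r_gap_decay A0 b0 C0 D1 n0 (fun=> erefl) dist gap0 k.+1.
have Tk1 : 10 * (D ^+ 2 / (eps * beta)) <= k.+1%:R.
  by apply: le_trans Tk _; rewrite ler_nat.
have gap_le := gap_le_of_threshold (ler0n _ n) e0 b0 b24 D0 Tk1 decay.
have su_ge : \sum_j ln (xs j 0) - n%:R * eps <= \sum_j u j 0.
  rewrite mulr_natl -[in X in _ *+ X](card_ord n) -sumr_const -sumrB.
  by apply: ler_sum => j _; exact: ln_interior_point_ge nA eps_lt xs_opt j.
exact: lin1 (f_r_ge A (x k.+1) b0 C0) fu_le su_ge gap_le.
Qed.
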